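(* Let $p$ be a prime number, let $n \ge 1$, and let $f \in \mathbb{Z}_p\{x_1,\dots,x_n\}$ be a non-zero restricted power series with $f(0) = 0$ that is non-degenerated over $\mathbb{F}_p$ with respect to all the faces of its Newton polyhedron $\Gamma(f)$. For $D \in \mathbb{N}$ let $f_D$ denote the polynomial obtained by only considering the terms of $f$ of (total) degree $\le D$. Then there exists $N \in \mathbb{N}$ such that for all $D \ge N$ the truncation $f_D$ has the same Igusa zeta function as $f$, i.e. $Z_{f_D}(s) = Z_f(s)$ for all $s \in \mathbb{C}$ with $\Re(s) > 0$.
   Context: $\mathbb{N}$ includes $0$. For $\omega = (\omega_1,\dots,\omega_n) \in \mathbb{N}^n$ write $|\omega| = \omega_1 + \dots + \omega_n$ and $x^\omega = x_1^{\omega_1}\cdots x_n^{\omega_n}$. $\mathbb{Z}_p\{x_1,\dots,x_n\}$ is the ring of formal power series $\sum_{\omega \in \mathbb{N}^n} a_\omega x^\omega$ with $a_\omega \in \mathbb{Z}_p$ and $|a_\omega|_p \to 0$ as $|\omega| \to \infty$; such a series converges at every $x \in \mathbb{Z}_p^n$. For $f = \sum_\omega a_\omega x^\omega$, the truncation is $f_D = \sum_{|\omega| \le D} a_\omega x^\omega$. Igusa zeta function: for $g \in \mathbb{Z}_p\{x_1,\dots,x_n\}$ and $\Re(s) > 0$, $Z_g(s) = \int_{\mathbb{Z}_p^n} |g(x)|_p^s\,|dx|$, where $|dx|$ is the Haar measure on $\mathbb{Q}_p^n$ normalized so that $\mathbb{Z}_p^n$ has measure $1$, $|\cdot|_p$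 is the $p$-adic absolute value with $|p|_p = p^{-1}$, and $|0|_p^s = 0$. Newton polyhedron: let $\mathbb{R}^+ = \{x \in \mathbb{R} : x \ge 0\}$ and $\mathrm{supp}(f) = \{\omega \in \mathbb{N}^n : a_\omega \ne 0\}$. For non-zero $f$ with $f(0)=0$, $\Gamma(f)$ is the convex hull in $(\mathbb{R}^+)^n$ of $\bigcup_{\omega \in \mathrm{supp}(f)} (\omega + (\mathbb{R}^+)^n)$. Faces of $\Gamma(f)$ are its non-empty faces as a convex polyhedron, including $\Gamma(f)$ itself and the non-compact faces; equivalently they are the sets $F(a) = \{z \in \Gamma(f) : a\cdot z = \inf_{y \in \Gamma(f)} a \cdot y\}$ for $a \in (\mathbb{R}^+)^n$ (with $F(0) = \Gamma(f)$). Non-degeneracy: for a face $\tau$ of $\Gamma(f)$ put $f_\tau(x) = \sum_{\omega \in \tau} a_\omega x^\omega$ (sum over $\omega \in \tau \cap \mathbb{N}^n$). $f$ is non-degenerated over $\mathbb{F}_p$ with respect to all the faces of $\Gamma(f)$ if for every face $\tau$ of $\Gamma(f)$ the set of congruences $f_\tau(x) \equiv 0 \bmod p$ and $\frac{\partial f_\tau}{\partial x_i}(x) \equiv 0 \bmod p$ for $i = 1,\dots,n$ has no solution in $(\mathbb{Z}_p^\times)^n$. *)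

(* Defs.v *)
From HB Require Import structures.
From mathcomp Require Import all_boot all_order all_algebra.
From mathcomp Require Import all_classical all_reals all_analysis.
From mathcomp Require Import complex.
From mathcomp Require mpoly.
(* The notations of mpoly clash with those of mathcomp-analysis; only its
   multi-indices (multinom, mdeg, bmultinom) are used. *)
Export -(notations) mpoly.

Set Implicit Arguments.
Unset Strict Implicit.
Unset Printing Implicit Defensive.

Import Order.TTheory GRing.Theory Num.Theory.
Import numFieldNormedType.Exports.

Local Open Scope classical_set_scope.
Local Open Scope ring_scope.

(* Z_p as the inverse limit of the rings Z/p^(k+1)Z.  The exponent starts at 1
   because 'Z_1 is Z/2Z in MathComp; for the same reason the type is only
   meaningful when 1 < p. *)
Record padic_int (p : nat) := PadicInt {
  residue : forall k, 'Z_(p ^ k.+1);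
  residueP : forall k, (residue k.+1 : nat)%:R = residue k
}.

Section PadicRing.
Variable p : nat.
Local Notation Zp := (padic_int p).
Implicit Types x y z : Zp.

Lemma padic_ext x y : (forall k, residue x k = residue y k) -> x = y.
Proof.
case: x y => [x hx] [y hy] /= exy.
have e : x = y by apply/functional_extensionality_dep => k; exact: exy.
by case: _ / e hy => hy; congr PadicInt; exact: Prop_irrelevance.
Qed.

Lemma Zp_trunc_dvd k :
  ((Zp_trunc (p ^ k.+1)).+2 %| (Zp_trunc (p ^ k.+2)).+2)%N.
Proof.
case: p => [|[|q]]; first by rewrite !exp0n.
  by rewrite !exp1n.
by rewrite !Zp_cast ?dvdn_exp2l// -[X in (X < _)%N](expn0 q.+2) ltn_exp2l.
Qed.

Lemma natr_mod k m :
  (m %% (Zp_trunc (p ^ k.+2)).+2)%:R = m%:R :> 'Z_(p ^ k.+1).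
Proof. by apply: val_inj; rewrite !Zp_nat/= modn_dvdm// Zp_trunc_dvd. Qed.

Lemma padic_const_subproof (m : nat) k :
  ((m%:R : 'Z_(p ^ k.+2)) : nat)%:R = m%:R :> 'Z_(p ^ k.+1).
Proof.
have -> : m%:R = inZp m :> 'Z_(p ^ k.+2) by exact: Zp_nat.
by rewrite /= natr_mod.
Qed.

Lemma padic_add_subproof x y k :
  (residue x k.+1 + residue y k.+1 : 'Z_(p ^ k.+2))%R%:R
  = residue x k + residue y k.
Proof. by rewrite /= natr_mod natrD !residueP. Qed.

Lemma padic_mul_subproof x y k :
  (residue x k.+1 * residue y k.+1 : 'Z_(p ^ k.+2))%R%:R
  = residue x k * residue y k.
Proof. by rewrite /= natr_mod natrM !residueP. Qed.

Lemma padic_opp_subproof x k :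
  (- residue x k.+1 : 'Z_(p ^ k.+2))%R%:R = - residue x k.
Proof.
apply/eqP; rewrite -addr_eq0 -[in X in _ + X](residueP x k) -natrD -natr_mod.
have /(congr1 val) /= := addNr (residue x k.+1).
by rewrite /= => ->.
Qed.

Definition padic_zero := PadicInt (padic_const_subproof 0).
Definition padic_one := PadicInt (padic_const_subproof 1).
Definition padic_add x y := PadicInt (padic_add_subproof x y).
Definition padic_mul x y := PadicInt (padic_mul_subproof x y).
Definition padic_opp x := PadicInt (padic_opp_subproof x).

HB.instance Definition _ := gen_eqMixin Zp.
HB.instance Definition _ := gen_choiceMixin Zp.

Lemma padic_addA : associative padic_add.
Proof. by move=> x y z; apply: padic_ext => k; exact: addrA. Qed.
Lemma padic_addC : commutative padic_add.
Proof. by move=> x y; apply: padic_ext => k; exact: addrC. Qed.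
Lemma padic_add0 : left_id padic_zero padic_add.
Proof. by move=> x; apply: padic_ext => k; exact: add0r. Qed.
Lemma padic_addN : left_inverse padic_zero padic_opp padic_add.
Proof. by move=> x; apply: padic_ext => k; exact: addNr. Qed.

HB.instance Definition _ :=
  GRing.isZmodule.Build Zp padic_addA padic_addC padic_add0 padic_addN.

Lemma padic_mulA : associative padic_mul.
Proof. by move=> x y z; apply: padic_ext => k; exact: mulrA. Qed.
Lemma padic_mulC : commutative padic_mul.
Proof. by move=> x y; apply: padic_ext => k; exact: mulrC. Qed.
Lemma padic_mul1 : left_id padic_one padic_mul.
Proof. by move=> x; apply: padic_ext => k; exact: mul1r. Qed.
Lemma padic_mulDl : left_distributive padic_mul +%R.
Proof. by move=> x y z; apply: padic_ext => k; exact: mulrDl. Qed.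
Lemma padic_oner_neq0 : padic_one != 0.
Proof.
apply/eqP => /(congr1 (fun x => residue x 0)) /eqP.
by rewrite /= (oner_eq0 'Z_(p ^ 1)).
Qed.

HB.instance Definition _ := GRing.Zmodule_isComNzRing.Build Zp
  padic_mulA padic_mulC padic_mul1 padic_mulDl padic_oner_neq0.

Definition padic_unit : {pred Zp} := fun x => `[< exists y, y * x = 1 >].

Definition padic_inv x : Zp :=
  if pselect (exists y, y * x = 1) is left h then projT1 (cid h) else x.

Lemma padic_mulVr : {in padic_unit, left_inverse 1 padic_inv *%R}.
Proof.
move=> x /asboolP xu; rewrite /padic_inv; case: pselect => // h.
exact: projT2 (cid h).
Qed.
Lemma padic_unitP x y : y * x = 1 -> padic_unit x.
Proof. by move=> yx; apply/asboolP; exists y. Qed.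
Lemma padic_inv_out : {in [predC padic_unit], padic_inv =1 id}.
Proof.
by move=> x /asboolP xu; rewrite /padic_inv; case: pselect.
Qed.

HB.instance Definition _ := GRing.ComNzRing_hasMulInverse.Build Zp
  padic_mulVr padic_unitP padic_inv_out.

(* The p-adic topology: the classes modulo p^(k+1) are the basic
   neighbourhoods. *)
Definition padic_nbhs x : set_system Zp :=
  [set A | exists k, [set y | residue y k = residue x k] `<=` A].

HB.instance Definition _ := hasNbhs.Build Zp padic_nbhs.

Lemma residue_le x y j k : (j <= k)%N ->
  residue x k = residue y k -> residue x j = residue y j.
Proof.
elim: k => [|k ih]; first by rewrite leqn0 => /eqP ->.
rewrite leq_eqVlt ltnS => /predU1P[->//|jk] xy.
by apply: ih => //; rewrite -(residueP x) -(residueP y) xy.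
Qed.

Lemma padic_nbhs_filter x : ProperFilter (nbhs x).
Proof.
apply: Build_ProperFilter_ex; first by move=> A [k kA]; exists x; exact: kA.
split; first by exists 0%N.
- move=> A B [j jA] [k kB]; exists (maxn j k) => y yx; split.
    by apply: jA; apply: residue_le yx; exact: leq_maxl.
  by apply: kB; apply: residue_le yx; exact: leq_maxr.
- by move=> A B AB [k kA]; exists k => y /kA/AB.
Qed.

Lemma padic_nbhs_singleton x (A : set Zp) : nbhs x A -> A x.
Proof. by move=> [k]; exact. Qed.

Lemma padic_nbhs_nbhs x (A : set Zp) : nbhs x A -> nbhs x (nbhs^~ A).
Proof.
move=> [k kA]; exists k => y yx; exists k => z zy.
by apply: kA; rewrite /= zy.
Qed.

HB.instance Definition _ := Nbhs_isNbhsTopological.Build Zp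
  padic_nbhs_filter padic_nbhs_singleton padic_nbhs_nbhs.

HB.instance Definition _ := isPointed.Build Zp 0.

End PadicRing.

(* |x|_p = p^(-k) where k = ord_p x is the least k such that x is non-zero
   modulo p^(k+1). *)
Definition padic_abs (R : realType) p (x : padic_int p) : R :=
  if pselect (exists k, residue x k != 0) is left h then p%:R ^- ex_minn h
  else 0.

(* A formal power series sum_w a_w x^w over Z_p is its coefficient family a. *)
Definition padic_series (p n : nat) := multinom n -> padic_int p.

Definition restricted (R : realType) p n (f : padic_series p n) : Prop :=
  forall e : R, 0 < e -> exists M, forall w : multinom n,
    (M <= mdeg w)%N -> padic_abs R (f w) < e.

Definition truncation p n (D : nat) (f : padic_series p n) : padic_series p n :=
  fun w => if (mdeg w <= D)%N then f w else 0.

Definition partial_sum p n (f : padic_series p n) (x : 'rV[padic_int p]_n)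
    (D : nat) : padic_int p :=
  \sum_(w : bmultinom n D.+1) f w * \prod_(i < n) x 0 i ^+ w i.

Definition padic_series_eval p n (f : padic_series p n) (x : 'rV[padic_int p]_n)
    : padic_int p :=
  lim (partial_sum f x D @[D --> \oo]).

Definition padic_series_deriv p n (i : 'I_n) (f : padic_series p n)
    : padic_series p n :=
  fun w => (w i).+1%:R * f (mnm_add w (mnm1 i)).

Notation padic_space p n := (g_sigma_algebraType (@open 'rV[padic_int p]_n)).

(* The restriction to Z_p^n of the Haar measure of Q_p^n normalized by
   mu(Z_p^n) = 1: it is the only translation-invariant Borel probability
   measure on Z_p^n. *)
Definition normalized_haar (R : realType) p n
    (mu : {measure set (padic_space p n) -> \bar R}) : Prop :=
  mu setT = 1%E /\
  forall (v : 'rV[padic_int p]_n) (A : set (padic_space p n)),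
    measurable A -> mu [set v + x | x in A] = mu A.

(* a^s for a >= 0 and Re s > 0, with 0^s = 0. *)
Definition cpow (R : realType) (a : R) (s : R[i]) : R[i] :=
  if a == 0 then 0
  else let r := expR (complex.Re s * ln a) in
       let t := complex.Im s * ln a in
       Complex (r * cos t) (r * sin t).

Definition igusa_zeta (R : realType) p n
    (mu : {measure set (padic_space p n) -> \bar R}) (g : padic_series p n)
    (s : R[i]) : R[i] :=
  let F (x : padic_space p n) := cpow (padic_abs R (padic_series_eval g x)) s in
  Complex (\int[mu]_x complex.Re (F x)) (\int[mu]_x complex.Im (F x)).

Section NewtonPolyhedron.
Variables (R : realType) (n : nat).

Definition orthant : set 'rV[R]_n := [set a | forall i, 0 <= a 0 i].

Definition exponent_point (w : multinom n) : 'rV[R]_n := \row_i (w i)%:R.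

Definition newton_polyhedron p (f : padic_series p n) : set 'rV[R]_n :=
  smallest (@convex_set R 'rV[R]_n)
    (\bigcup_(w in [set w | f w != 0])
       [set exponent_point w + v | v in orthant]).

Definition dot (a z : 'rV[R]_n) : R := \sum_(i < n) a 0 i * z 0 i.

(* F(a); these sets, for a in the orthant, are the non-empty faces of P when
   P is a Newton polyhedron, with F(0) = P. *)
Definition meet_locus (P : set 'rV[R]_n) (a : 'rV[R]_n) : set 'rV[R]_n :=
  [set z | P z /\ dot a z = inf [set dot a y | y in P]].

Definition newton_face p (f : padic_series p n) (tau : set 'rV[R]_n) : Prop :=
  exists2 a, orthant a & tau = meet_locus (newton_polyhedron f) a.

Definition face_part p (f : padic_series p n) (tau : set 'rV[R]_n)
    : padic_series p n :=
  fun w => if exponent_point w \in tau then f w else 0.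

Definition nondegenerated p (f : padic_series p n) : Prop :=
  let zero_mod_p (y : padic_int p) := exists z : padic_int p, y = p%:R * z in
  forall tau, newton_face f tau ->
    ~ exists x : 'rV[padic_int p]_n,
        [/\ forall i, x 0 i \is a GRing.unit,
            zero_mod_p (padic_series_eval (face_part f tau) x) &
            forall i,
              zero_mod_p
                (padic_series_eval (padic_series_deriv i (face_part f tau)) x)].

End NewtonPolyhedron.

(* Main.v *)
Require Import Defs.
From HB Require Import structures.
From mathcomp Require Import all_boot all_order all_algebra.
From mathcomp Require Import all_classical all_reals all_analysis.
From mathcomp Require Import complex.
From mathcomp Require Import ring zify.

Set Implicit Arguments.
Unset Strict Implicit.
Unset Printing Implicit Defensive.

Import Order.TTheory GRing.Theory Num.Theory.
Import numFieldNormedType.Exports.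

Local Open Scope classical_set_scope.
Local Open Scope ring_scope.

(** The integral Z_f(s) depends only on the distribution of |f(x)|, that is, on the
measures of the sets of zeros of f modulo p^t (Rintegral_padic_abs_eq).  Modulo
p^t, the series f coincides with its truncation f_E for all large E (eval_congr).
So it suffices to find N such that, for each t, the measure of the zeros of f_D
modulo p^t is the same for all D > N (partial_sum_measure_eq).  Any N works for
which the coefficients of degree at least N are divisible by p.

To see this, fix t and cut Z_p^n into the finitely many classes of points that
have the same valuations k_i, capped at t, and the same first digits after them.
On a class x = p^k u, with u determined modulo p.  Let m be the minimum of the
weight k on the support of f, and tau the face where it is attained
(face_of_weight).  Then f_D(p^k u) = p^m g_D(u) with g_D = f_tau modulo p.  Three
cases are possible (class_alternative).  If m is at least t, the whole class
consists of zeros.  If f_tau(u) is not 0 modulo p, the class contains no zeros.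
Otherwise, non-degeneracy makes some partial derivative of f_tau at u a unit, and
as in Hensel's lemma exactly one of p^e successive translates of a point by p^(k_i+1)
in the i-th coordinate is a zero, where e = t - m - 1.  By translation invariance,
the zeros then take up the fraction p^(-e) of the class (measure_transversal).
None of these answers involves D.

The faces of f and f_D are thus compared only through f_tau modulo p.  This is
enough because non-degeneracy makes f_tau non-zero modulo p for every face: in
particular the coefficients at the vertices are units, so all the vertices have
degree less than N. *)

(** * Divisibility by powers of p *)

Section PadicDivisibility.
Variables (p : nat) (p_prime : prime p).
Local Notation Zp := (padic_int p).
Implicit Types x y z : Zp.

Definition ppow_dvd (t : nat) x := exists z, x = p%:R ^+ t * z.

Let p_gt1 : (1 < p)%N. Proof. exact: prime_gt1. Qed.
Let p_gt0 : (0 < p)%N. Proof. exact: prime_gt0. Qed.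

Lemma ppow_gt1 k : (1 < p ^ k.+1)%N.
Proof. by rewrite -[X in (X < _)%N](expn0 p) ltn_exp2l. Qed.

Lemma eq_natr_Zp k (a b : nat) :
  (a%:R = b%:R :> 'Z_(p ^ k.+1)) <-> a = b %[mod p ^ k.+1].
Proof.
rewrite !Zp_nat; split=> [/(congr1 val)/=|]; rewrite ?Zp_cast ?ppow_gt1 //.
by move=> ab; apply: val_inj; rewrite /= Zp_cast ?ppow_gt1.
Qed.

Lemma residueD x y k : residue (x + y) k = residue x k + residue y k.
Proof. by []. Qed.
Lemma residueM x y k : residue (x * y) k = residue x k * residue y k.
Proof. by []. Qed.
Lemma residueB x y k : residue (x - y) k = residue x k - residue y k.
Proof. by []. Qed.
Lemma residue0 k : residue (0 : Zp) k = 0.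
Proof. by []. Qed.
Lemma residue1 k : residue (1 : Zp) k = 1.
Proof. by []. Qed.
Lemma residue_nat m k : residue (m%:R : Zp) k = m%:R.
Proof. by elim: m => [//|m ih]; rewrite !mulrSr residueD ih residue1. Qed.
Lemma residueX x m k : residue (x ^+ m) k = residue x k ^+ m.
Proof.
by elim: m => [|m ih]; rewrite ?expr0 ?residue1 // !exprS residueM ih.
Qed.

Lemma residue_mod x j k : (j <= k)%N ->
  (residue x k : nat) = residue x j %[mod p ^ j.+1].
Proof.
move=> jk; apply/eq_natr_Zp; rewrite [RHS]natr_Zp.
elim: k jk => [|k ih]; first by rewrite leqn0 => /eqP ->; rewrite natr_Zp.
rewrite leq_eqVlt ltnS => /predU1P[->|jk]; first by rewrite natr_Zp.
rewrite -(ih jk); apply/eq_natr_Zp.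
have /eq_natr_Zp : (residue x k.+1 : nat)%:R = (residue x k : nat)%:R
   :> 'Z_(p ^ k.+1) by rewrite residueP natr_Zp.
move=> /(congr1 (modn^~ (p ^ j.+1)%N)).
by rewrite !modn_dvdm // dvdn_exp2l.
Qed.

(** Completeness of Z_p, in the form in which quotients, inverses and limits of
partial sums are constructed below. *)
Lemma padic_of_residues (Y : nat -> nat) :
  (forall j, Y j.+1 = Y j %[mod p ^ j.+1]) ->
  exists z : Zp, forall j, residue z j = (Y j)%:R.
Proof.
move=> Ycoh.
have Yp k : ((Y k.+1)%:R : 'Z_(p ^ k.+2))%R%:R = (Y k)%:R :> 'Z_(p ^ k.+1).
  by rewrite padic_const_subproof; apply/eq_natr_Zp.
by exists (PadicInt Yp).
Qed.

Lemma ppow_dvd0 x : ppow_dvd 0 x.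
Proof. by exists x; rewrite expr0 mul1r. Qed.

(** When the residue of index k vanishes, the residues of higher index are
divisible by p^(k+1) as natural numbers, and their quotients are coherent. *)
Lemma ppow_dvdP x k : ppow_dvd k.+1 x <-> residue x k = 0.
Proof.
split=> [[z ->]|xk].
  rewrite residueM residueX residue_nat -natrX.
  rewrite (_ : (_ ^ _)%:R = 0) ?mul0r //; apply/(eq_natr_Zp _ _ 0).
  by rewrite modnn mod0n.
pose X j := (residue x j : nat).
have dvdX j : (p ^ k.+1 %| X (k.+1 + j))%N.
  have := residue_mod x (leq_trans (leqnSn k) (leq_addr j k.+1)).
  by rewrite xk [in RHS]/= mod0n /dvdn => ->.
pose Y j := (X (k.+1 + j) %/ p ^ k.+1)%N.
have XY j : X (k.+1 + j)%N = (p ^ k.+1 * Y j)%N by rewrite mulnC divnK.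
have [|z zY] := @padic_of_residues Y.
  move=> j; have := @residue_mod x (k.+1 + j)%N (k.+1 + j.+1)%N.
  rewrite leq_add2l leqnSn => /(_ isT); rewrite -/(X _) -/(X _) !XY -addnS expnD.
  rewrite -!muln_modr => /eqP; rewrite eqn_pmul2l ?expn_gt0 ?p_gt0 //.
  by move/eqP.
exists z; apply: padic_ext => j.
rewrite residueM residueX residue_nat zY -natrX -natrM -XY.
have /eq_natr_Zp -> := residue_mod x (leq_addl k.+1 j).
by rewrite natr_Zp.
Qed.

Lemma ppow_dvdW s t x : (s <= t)%N -> ppow_dvd t x -> ppow_dvd s x.
Proof.
by move=> st [z ->]; exists (p%:R ^+ (t - s) * z); rewrite mulrA -exprD subnKC.
Qed.

Lemma ppow_dvdD t x y : ppow_dvd t x -> ppow_dvd t y -> ppow_dvd t (x + y).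
Proof. by move=> [a ->] [b ->]; exists (a + b); rewrite mulrDr. Qed.

Lemma ppow_dvdN t x : ppow_dvd t x -> ppow_dvd t (- x).
Proof. by move=> [a ->]; exists (- a); rewrite mulrN. Qed.

Lemma ppow_dvdB t x y : ppow_dvd t x -> ppow_dvd t y -> ppow_dvd t (x - y).
Proof. by move=> px /ppow_dvdN; exact: ppow_dvdD. Qed.

Lemma ppow_dvd_zero t : ppow_dvd t 0.
Proof. by exists 0; rewrite mulr0. Qed.

Lemma ppow_dvdMl t x y : ppow_dvd t y -> ppow_dvd t (x * y).
Proof. by move=> [a ->]; exists (x * a); rewrite mulrCA. Qed.

Lemma ppow_dvdMr t x y : ppow_dvd t x -> ppow_dvd t (x * y).
Proof. by rewrite mulrC; exact: ppow_dvdMl. Qed.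

Lemma ppow_dvd_exp t x : ppow_dvd t (p%:R ^+ t * x).
Proof. by exists x. Qed.

Lemma ppow_dvd_sum (I : Type) (r : seq I) (P : pred I) (F : I -> Zp) t :
  (forall i, P i -> ppow_dvd t (F i)) -> ppow_dvd t (\sum_(i <- r | P i) F i).
Proof.
move=> PF; elim/big_rec : _ => [|i x Pi]; first exact: ppow_dvd_zero.
by apply: ppow_dvdD; exact: PF.
Qed.

Lemma ppow_dvd_congr t x y : ppow_dvd t (x - y) -> ppow_dvd t x <-> ppow_dvd t y.
Proof.
move=> xy; split=> [px|py]; last by rewrite -(subrK y x); exact: ppow_dvdD.
by rewrite -(subKr x y); exact: ppow_dvdB.
Qed.

Lemma ppow_dvd_cancel s t x :
  ppow_dvd (s + t) (p%:R ^+ s * x) <-> ppow_dvd t x.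
Proof.
split=> [|[z ->]]; last by exists z; rewrite exprD mulrA.
case: t => [_|k]; first exact: ppow_dvd0.
rewrite addnS => /ppow_dvdP sk; apply/ppow_dvdP.
rewrite -(natr_Zp (residue x k)); apply/(eq_natr_Zp _ _ 0).
rewrite -(residue_mod x (leq_addl s k)) mod0n; apply/eqP.
have {sk} : (p%:R ^+ s * (residue x (s + k) : nat)%:R : 'Z_(p ^ (s + k).+1)) = 0.
  by rewrite natr_Zp -residue_nat -residueX.
move: (residue x (s + k) : nat) => a.
rewrite -natrX -natrM => /(eq_natr_Zp _ _ 0) /eqP.
by rewrite mod0n -addnS expnD -/(dvdn _ _) dvdn_pmul2l ?expn_gt0 ?p_gt0.
Qed.

Lemma padic_p_cancel s x y : p%:R ^+ s * x = p%:R ^+ s * y -> x = y.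
Proof.
move=> /eqP; rewrite -subr_eq0 -mulrBr => /eqP xy0.
apply/eqP; rewrite -subr_eq0; apply/eqP/padic_ext => k.
rewrite residue0; apply/ppow_dvdP; rewrite -(ppow_dvd_cancel s) xy0.
exact: ppow_dvd_zero.
Qed.

Lemma ppow_dvd_nat t (a : nat) : ppow_dvd t (a%:R : Zp) <-> (p ^ t %| a)%N.
Proof.
case: t => [|k]; first by split=> // _; exact: ppow_dvd0.
rewrite ppow_dvdP residue_nat; split.
  by move=> /(eq_natr_Zp _ _ 0) /eqP; rewrite mod0n.
by move=> /eqP pa; apply/(eq_natr_Zp _ _ 0); rewrite mod0n.
Qed.

(** The inverses modulo the powers of p are coherent, because an inverse modulo
p^(j+2) is also one modulo p^(j+1). *)
Lemma padic_unit_ndvd x : ~ ppow_dvd 1 x -> x \is a GRing.unit.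
Proof.
move=> xNp.
have xu j : residue x j \is a GRing.unit.
  rewrite -(natr_Zp (residue x j)) unitZpE ?ppow_gt1 // coprime_pexpl //.
  rewrite prime_coprime //; apply/negP => pxj; apply: xNp; apply/ppow_dvdP.
  rewrite -(natr_Zp (residue x 0)); apply/(eq_natr_Zp _ _ 0).
  by rewrite -(residue_mod x (leq0n j)) mod0n; apply/eqP.
pose Y j := ((residue x j)^-1 : 'Z_(p ^ j.+1)) : nat.
have YX j : ((Y j)%:R : 'Z_(p ^ j.+1)) * residue x j = 1.
  by rewrite natr_Zp mulVr ?xu.
have [|z zY] := @padic_of_residues Y.
  move=> j; apply/eq_natr_Zp; apply: (mulIr (xu j)); rewrite YX.
  have := congr1 val (YX j.+1); have := residueP x j.
  move: (residue x j.+1) => r <- /(congr1 (fun m => m%:R : 'Z_(p ^ j.+1))).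
  by rewrite /= natr_mod natrM natr_Zp natr_mod.
apply/unitrP; exists z; suff zx : z * x = 1 by split; rewrite // mulrC.
by apply: padic_ext => j; rewrite residueM zY YX.
Qed.

Lemma ppow_dvd_unitM t x c : ~ ppow_dvd 1 c -> ppow_dvd t (x * c) <-> ppow_dvd t x.
Proof.
move=> /padic_unit_ndvd cu; split=> [|px]; last exact: ppow_dvdMr.
by move=> /(ppow_dvdMr c^-1); rewrite mulrK.
Qed.

(** Hensel's lemma in the form of a count: such an h is injective modulo p^e on
p^e consecutive integers, hence bijective onto the residues modulo p^e. *)
Lemma uniq_zero_mod_ppow (h : nat -> Zp) e :
  (forall i j, exists c, ~ ppow_dvd 1 c /\ h i - h j = (i%:R - j%:R) * c) ->
  exists! j : 'I_(p ^ e), ppow_dvd e (h j).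
Proof.
move=> hc; case: e => [|e].
  have lt01 : (0 < p ^ 0)%N by rewrite expn0.
  exists (Ordinal lt01); split; first exact: ppow_dvd0.
  by case=> j jlt _; apply: val_inj => /=; case: j jlt.
have sym i j : ppow_dvd e.+1 (h i - h j) -> (j <= i)%N -> (i < p ^ e.+1)%N -> i = j.
  have [c [cu ->]] := hc i j; rewrite ppow_dvd_unitM // => + ji ilt.
  rewrite -natrB // ppow_dvd_nat // => pij.
  case: (posnP (i - j)) => [|/dvdn_leq /(_ pij)]; first by lia.
  by rewrite leqNgt (leq_ltn_trans (leq_subr _ _)).
pose F (j : 'I_(p ^ e.+1)) := residue (h j) e.
have F_inj : injective F.
  move=> i j Fij; have hij : ppow_dvd e.+1 (h i - h j).
    by apply/ppow_dvdP; rewrite residueB -/(F i) Fij subrr.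
  apply: val_inj; case: (leqP j i) => [ji|/ltnW ij].
    exact: (sym _ _ hij ji (ltn_ord i)).
  by apply: esym; apply: (sym _ _ _ ij (ltn_ord j)); rewrite -opprB; exact: ppow_dvdN.
have [|G _ GF] := inj_card_bij F_inj.
  by rewrite !card_ord Zp_cast ?ppow_gt1.
exists (G 0); split; first by apply/ppow_dvdP; rewrite -/(F _) GF.
by move=> j /ppow_dvdP hj; apply: F_inj; rewrite GF.
Qed.

End PadicDivisibility.

(** * Partial sums of a power series *)

Section PartialSums.
Variables (p n : nat) (p_prime : prime p).
Local Notation Zp := (padic_int p).
Implicit Types (f g : padic_series p n) (x : 'rV[Zp]_n) (w : multinom n).

Definition monomial x w : Zp := \prod_(i < n) x 0 i ^+ w i.

Lemma sum_bmultinom_widen (F : multinom n -> Zp) D E : (D <= E)%N ->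
  \sum_(w : bmultinom n D) F w = \sum_(w : bmultinom n E | (mdeg w < D)%N) F w.
Proof.
move=> DE; pose h (w : bmultinom n D) := BMultinom (leq_trans (bmdeg w) DE).
rewrite (reindex_omap h (fun w : bmultinom n E => insub (w : multinom n))) /=; last first.
  by move=> w wD; rewrite insubT /=; congr Some; apply: val_inj.
by apply: eq_bigl => w; rewrite bmdeg valK eqxx.
Qed.

Lemma partial_sum_truncation f x D E : (D <= E)%N ->
  partial_sum (truncation D f) x E = partial_sum f x D.
Proof.
move=> DE; rewrite /partial_sum.
rewrite (@sum_bmultinom_widen (fun w => f w * monomial x w) D.+1 E.+1) //.
rewrite [RHS]big_mkcond; apply: eq_bigr => w _.
by rewrite /truncation ltnS; case: ifP => // _; rewrite mul0r.
Qed.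

Lemma partial_sum_congr f g x D t :
  (forall w, (mdeg w <= D)%N -> ppow_dvd t (f w - g w)) ->
  ppow_dvd t (partial_sum f x D - partial_sum g x D).
Proof.
move=> fg; rewrite /partial_sum -sumrB; apply: ppow_dvd_sum => w _.
by rewrite -mulrBl; apply: ppow_dvdMr; apply: fg; rewrite -ltnS bmdeg.
Qed.

Lemma partial_sum_tail f x M D E t :
  (forall w, (M <= mdeg w)%N -> ppow_dvd t (f w)) -> (M <= D)%N -> (M <= E)%N ->
  ppow_dvd t (partial_sum f x E - partial_sum f x D).
Proof.
move=> fM; wlog DE : D E / (D <= E)%N.
  move=> hw MD ME; case: (leqP D E) => [|/ltnW] DE; first exact: hw.
  by rewrite -opprB; apply: ppow_dvdN; exact: hw.
move=> MD _; rewrite -(partial_sum_truncation f x DE).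
apply: partial_sum_congr => w _; rewrite /truncation; case: leqP => wD.
  by rewrite subrr; exact: ppow_dvd_zero.
by rewrite subr0; apply: fM; rewrite (leq_trans MD) // ltnW.
Qed.

(** Restricted series, phrased with divisibility instead of the real-valued
absolute value. *)
Definition coef_tends0 f :=
  forall t, exists M, forall w, (M <= mdeg w)%N -> ppow_dvd t (f w).

Lemma restricted_tends0 (R : realType) f : restricted R f -> coef_tends0 f.
Proof.
move=> fR [|k]; first by exists 0%N => w _; exact: ppow_dvd0.
have p0 : 0 < (p%:R : R) by rewrite ltr0n prime_gt0.
have [|M MP] := fR (p%:R ^- k); first by rewrite invr_gt0 exprn_gt0.
exists M => w /MP; rewrite /padic_abs; case: pselect => [h|h _].
  case: ex_minnP => j fj jmin; rewrite ltf_pV2 ?posrE ?exprn_gt0 // => kj.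
  apply/(ppow_dvdP p_prime)/eqP; apply/negPn/negP => /jmin.
  by rewrite leqNgt; move: kj; rewrite ltr_eXn2l ?ltr1n ?prime_gt1 // => ->.
apply/(ppow_dvdP p_prime)/eqP/negPn/negP => fk; apply: h; by exists k.
Qed.

(** The residues of the partial sums are eventually constant, so the partial sums
converge; modulo p^t, their limit is any partial sum which contains all the
monomials whose coefficient is not divisible by p^t. *)
Lemma eval_congr f x M D t : coef_tends0 f ->
  (forall w, (M <= mdeg w)%N -> ppow_dvd t (f w)) -> (M <= D)%N ->
  ppow_dvd t (padic_series_eval f x - partial_sum f x D).
Proof.
move=> f0 fM MD; case: t => [|k] in fM *; first exact: ppow_dvd0.
have [m mP] := choice f0.
have res_eq (j D1 D2 : nat) : (m j.+1 <= D1)%N -> (m j.+1 <= D2)%N ->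
    residue (partial_sum f x D1) j = residue (partial_sum f x D2) j.
  move=> D1m D2m; apply/eqP; rewrite -subr_eq0 -residueB; apply/eqP.
  apply/(ppow_dvdP p_prime); exact: partial_sum_tail (@mP j.+1) _ _.
pose Y j := (residue (partial_sum f x (m j.+1)) j : nat).
have [|z zY] := padic_of_residues p_prime (Y := Y).
  move=> j; pose E := maxn (m j.+1) (m j.+2).
  rewrite /Y (res_eq j _ E) ?leq_maxl // (res_eq j.+1 _ E) ?leq_maxr //.
  exact: residue_mod.
have cvz : partial_sum f x D @[D --> \oo] --> z.
  move=> A [j jA]; exists (m j.+1) => // E /= mE; apply: jA => /=.
  by rewrite (res_eq _ _ _ mE (leqnn _)) zY natr_Zp.
have := cvgP _ cvz => /(_ [set y | residue y k = residue (padic_series_eval f x) k]).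
case; first by exists k.
move=> E _ /(_ (maxn E D)) /=; rewrite leq_maxl => /(_ isT) evalE.
rewrite -(subrKA (partial_sum f x (maxn E D))); apply: ppow_dvdD.
  by apply/(ppow_dvdP p_prime); rewrite residueB evalE subrr.
by apply: partial_sum_tail fM _ _; rewrite // (leq_trans MD) // leq_maxr.
Qed.

Lemma tends0_truncation f D : coef_tends0 (truncation D f).
Proof.
move=> t; exists D.+1 => w; rewrite /truncation leqNgt ltnS => /negbTE ->.
exact: ppow_dvd_zero.
Qed.

Lemma eval_truncation f x D :
  padic_series_eval (truncation D f) x = partial_sum f x D.
Proof.
apply/eqP; rewrite -subr_eq0; apply/eqP/padic_ext => k.
rewrite residue0; apply/(ppow_dvdP p_prime).
have tD := tends0_truncation f D.
have [M MP] := tD k.+1; rewrite -(partial_sum_truncation f x (leq_maxl D M)).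
exact: eval_congr tD MP (leq_maxr _ _).
Qed.

Lemma taylor_power (a d : Zp) m :
  exists r, (a + d) ^+ m - a ^+ m = d * (m%:R * a ^+ m.-1 + d * r).
Proof.
elim: m => [|m [r hr]]; first by exists 0; rewrite !expr0 subrr mul0r mulr0 addr0 mulr0.
exists (m%:R * a ^+ m.-1 + (a + d) * r).
have -> : (a + d) ^+ m.+1 - a ^+ m.+1
    = (a + d) * ((a + d) ^+ m - a ^+ m) + d * a ^+ m by rewrite !exprS; ring.
rewrite hr -pred_Sn; case: m {hr} => [|m] /=; first by rewrite !expr0; ring.
by rewrite exprS -natr1; ring.
Qed.

Lemma taylor_monomial x (i : 'I_n) (d : Zp) w :
  exists r, monomial (x + d *: delta_mx 0 i) w - monomial x w =
    d * ((w i)%:R * monomial x (mnm_sub w (mnm1 i)) + d * r).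
Proof.
have [r hr] := taylor_power (x 0 i) d (w i).
pose rest := \prod_(j < n | j != i) x 0 j ^+ w j.
have -> : monomial (x + d *: delta_mx 0 i) w = (x 0 i + d) ^+ w i * rest.
  rewrite /monomial (bigD1 i) //= !mxE !eqxx mulr1; congr (_ * _).
  by apply: eq_bigr => j ji; rewrite !mxE (negbTE ji) andbF mulr0 addr0.
have -> : monomial x w = x 0 i ^+ w i * rest by rewrite /monomial (bigD1 i).
have -> : monomial x (mnm_sub w (mnm1 i)) = x 0 i ^+ (w i).-1 * rest.
  rewrite /monomial (bigD1 i) //= mnmBE mnm1E eqxx subn1; congr (_ * _).
  by apply: eq_bigr => j ji; rewrite mnmBE mnm1E eq_sym (negbTE ji) subn0.
exists (r * rest); rewrite -mulrBl hr; ring.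
Qed.

Lemma partial_sum_deriv g x (i : 'I_n) D :
  partial_sum (padic_series_deriv i g) x D =
  \sum_(w : bmultinom n D.+2) g w * ((w i)%:R * monomial x (mnm_sub w (mnm1 i))).
Proof.
rewrite [RHS](bigID (fun w : bmultinom n D.+2 => w i != 0)) /=.
rewrite [X in _ + X]big1 ?addr0; last first.
  by move=> w; rewrite negbK => /eqP ->; rewrite mul0r mulr0.
have h_lt (w : bmultinom n D.+1) : (mdeg (mnm_add w (mnm1 i)) < D.+2)%N.
  by rewrite mdegD mdeg1 addn1 ltnS bmdeg.
pose h (w : bmultinom n D.+1) := BMultinom (h_lt w).
pose h' (w : bmultinom n D.+2) : option (bmultinom n D.+1) :=
  insub (mnm_sub w (mnm1 i)).
have sub_add (w : multinom n) : w i != 0 -> mnm_add (mnm_sub w (mnm1 i)) (mnm1 i) = w.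
  by move=> wi; rewrite submK // lep1mP.
rewrite (reindex_omap h h') /=; last first.
  move=> w wi; rewrite /h' insubT /=; last first.
    by move=> ?; congr Some; apply: val_inj; exact: sub_add.
  by have := bmdeg w; rewrite -{1}(sub_add w wi) mdegD mdeg1 addn1 ltnS.
apply: eq_big => [w|w _].
  by rewrite mnmDE mnm1E eqxx addn1 /= /h' /= addmK valK eqxx.
by rewrite addmK mnmDE mnm1E eqxx addn1 /padic_series_deriv mulrCA mulrA.
Qed.

Lemma taylor_partial_sum g x (i : 'I_n) (d : Zp) D :
  exists r, partial_sum g (x + d *: delta_mx 0 i) D.+1 - partial_sum g x D.+1 =
    d * (partial_sum (padic_series_deriv i g) x D + d * r).
Proof.
have [r rP] := choice (taylor_monomial x i d).
exists (\sum_(w : bmultinom n D.+2) g w * r w).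
rewrite partial_sum_deriv mulr_sumr -big_split mulr_sumr /partial_sum -sumrB.
apply: eq_bigr => w _.
rewrite -mulrBr -!/(monomial _ _) rP /=; ring.
Qed.

End PartialSums.

(** * The face of the Newton polyhedron selected by a weight *)

Section FaceOfWeight.
Variables (R : realType) (p n : nat).
Implicit Types (f : padic_series p n) (w : multinom n) (k : 'I_n -> nat).

Definition weight k w : nat := \sum_(i < n) k i * w i.

(** The face F(k) of an integral vector k, seen from the support of f: the half-space
of the points of weight at least m is convex and contains the generators of the
polyhedron, hence the polyhedron, and m is attained on the support.  So the
infimum that defines F(k) is m. *)
Lemma face_of_weight f k : (exists w, f w != 0) ->
  exists m tau, [/\ newton_face (R := R) f tau,
    exists2 w, f w != 0 & weight k w = m,
    forall w, f w != 0 -> (m <= weight k w)%N &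
    forall w, f w != 0 -> (exponent_point R w \in tau) = (weight k w == m)].
Proof.
move=> f_neq0.
have /ex_minnP[m /asboolP[w0 fw0 w0m] mmin] :
    exists m, `[< exists2 w, f w != 0 & weight k w = m >].
  by have [w fw] := f_neq0; exists (weight k w); apply/asboolP; exists w.
have mle w : f w != 0 -> (m <= weight k w)%N.
  by move=> fw; apply: mmin; apply/asboolP; exists w.
pose a : 'rV[R]_n := \row_i (k i)%:R.
have dota w : dot a (exponent_point R w) = (weight k w)%:R.
  by rewrite /dot natr_sum; apply: eq_bigr => i _; rewrite !mxE natrM.
have dotD u v : dot a (u + v) = dot a u + dot a v.
  by rewrite /dot -big_split; apply: eq_bigr => i _; rewrite !mxE mulrDr.
have dotZ c v : dot a (c *: v) = c * dot a v.
  by rewrite /dot mulr_sumr; apply: eq_bigr => i _; rewrite !mxE mulrCA.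
pose G : set 'rV[R]_n := newton_polyhedron (R := R) f.
have GP w : f w != 0 -> G (exponent_point R w).
  move=> fw; apply: sub_gen_smallest; exists w => //; exists 0; rewrite ?addr0 //.
  by move=> i; rewrite mxE.
have Gle z : G z -> m%:R <= dot a z.
  apply: (@smallest_sub _ _ _ [set z | m%:R <= dot a z]).
    move=> u v l; rewrite !inE /= => mu mv.
    rewrite dotD !dotZ.
    rewrite -[leLHS](subrK (l%:num * m%:R)) addrC lerD ?ler_wpM2l //.
    by rewrite -{1}(mul1r m%:R) -mulrBl ler_wpM2l // onem_ge0.
  move=> z' [w fw [v v0 <-]] /=; rewrite dotD dota -[leLHS]addr0.
  rewrite lerD ?ler_nat ?mle // sumr_ge0 // => i _.
  by rewrite mulr_ge0 // mxE ler0n.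
have infG : inf [set dot a y | y in G] = m%:R.
  have Gm : [set dot a y | y in G] m%:R.
    by exists (exponent_point R w0); [exact: GP|rewrite dota w0m].
  apply/eqP; rewrite eq_le; apply/andP; split.
    apply: ge_inf => //; exists m%:R => _ [y Gy <-]; exact: Gle.
  by apply: lb_le_inf; [exists m%:R|move=> _ [y Gy <-]; exact: Gle].
exists m, (meet_locus G a); split=> //.
- by exists a => // i; rewrite mxE.
- by exists w0.
- move=> w fw; rewrite -(eqr_nat R) -dota.
  apply/idP/eqP; first by rewrite inE => -[_ ->].
  by move=> wm; rewrite inE; split; [exact: GP|rewrite infG].
Qed.

End FaceOfWeight.

(** * Classes of points with the same leading digits *)

Section CongruentPoints.
Variables (p n : nat) (p_prime : prime p).
Local Notation Zp := (padic_int p).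
Implicit Types (f g : padic_series p n) (x y : 'rV[Zp]_n).

Lemma ppow_dvd_subM t (a b c d : Zp) :
  ppow_dvd t (a - b) -> ppow_dvd t (c - d) -> ppow_dvd t (a * c - b * d).
Proof.
move=> ab cd; have -> : a * c - b * d = (a - b) * c + b * (c - d) by ring.
by apply: ppow_dvdD; [exact: ppow_dvdMr|exact: ppow_dvdMl].
Qed.

Lemma ppow_dvd_subX t (a b : Zp) m :
  ppow_dvd t (a - b) -> ppow_dvd t (a ^+ m - b ^+ m).
Proof. by move=> ab; rewrite subrXX; exact: ppow_dvdMr. Qed.

Lemma partial_sum_congr_point f x y D t :
  (forall i, ppow_dvd t (x 0 i - y 0 i)) ->
  ppow_dvd t (partial_sum f x D - partial_sum f y D).
Proof.
move=> xy; rewrite /partial_sum -sumrB; apply: ppow_dvd_sum => w _.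
rewrite -mulrBr; apply: ppow_dvdMl.
apply: (big_ind2 (fun a b => ppow_dvd t (a - b))).
- by rewrite subrr; exact: ppow_dvd_zero.
- by move=> a b c d; exact: ppow_dvd_subM.
- by move=> i _; exact: ppow_dvd_subX.
Qed.

(** The cap at t leaves finitely many valuation vectors when one works modulo p^t,
and it treats the points with a zero coordinate like all the others. *)
Definition capval t (x : Zp) : nat := find (fun j => residue x j != 0) (iota 0 t).

Lemma capval_le t (x : Zp) : (capval t x <= t)%N.
Proof. by rewrite -{2}(size_iota 0 t) find_size. Qed.

Lemma residue_lt_capval t (x : Zp) j : (j < capval t x)%N -> residue x j = 0.
Proof.
move=> jc; have := before_find 0%N jc.
by rewrite nth_iota ?(leq_trans jc (capval_le t x)) // => /negbFE/eqP.
Qed.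

Lemma residue_capval t (x : Zp) :
  (capval t x < t)%N -> residue x (capval t x) != 0.
Proof.
move=> ct; have /(nth_find 0%N) : has (fun j => residue x j != 0) (iota 0 t).
  by rewrite has_find size_iota.
by rewrite -/(capval t x) nth_iota // add0n.
Qed.

Lemma ppow_dvd_capval t (x : Zp) : ppow_dvd (capval t x) x.
Proof.
case: (capval t x) (@residue_lt_capval t x) => [|c] xc; first exact: ppow_dvd0.
by apply/(ppow_dvdP p_prime)/xc.
Qed.

Lemma capval_unit t (x u : Zp) : (capval t x < t)%N ->
  x = p%:R ^+ capval t x * u -> ~ ppow_dvd 1 u.
Proof.
move=> ct xu pu; have /eqP[] := residue_capval ct.
apply/(ppow_dvdP p_prime); rewrite {2}xu -addn1.
exact/(ppow_dvd_cancel p_prime).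
Qed.

Lemma capval_congr t (x y : Zp) : ppow_dvd (capval t x).+1 (y - x) ->
  capval t y = capval t x.
Proof.
move=> yx; have res_eq j : (j <= capval t x)%N -> residue y j = residue x j.
  move=> jc; apply/eqP; rewrite -subr_eq0 -residueB; apply/eqP.
  by apply/(ppow_dvdP p_prime); apply: ppow_dvdW yx.
apply/eqP; rewrite eqn_leq; apply/andP; split; rewrite leqNgt; apply/negP => lt_cap.
  have /eqP[] := residue_capval (leq_trans lt_cap (capval_le t y)).
  by rewrite -res_eq //; exact: residue_lt_capval lt_cap.
have /eqP[] := residue_capval (leq_trans lt_cap (capval_le t x)).
by rewrite res_eq 1?ltnW //; exact: residue_lt_capval lt_cap.
Qed.

(** On such a class, the capped valuations k_i are constant, so are the coordinates
modulo p after division by p^(k_i), and the translations of the i-th coordinate by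
multiples of p^(k_i+1) preserve the class. *)
Definition same_class t x y :=
  forall i, ppow_dvd (capval t (x 0 i)).+1 (y 0 i - x 0 i).

(** A complete invariant of same_class with values in a finite type.  Scaling by
p^(t - k) moves the k + 1 relevant digits of a coordinate of capped valuation k
into the range of the residue of index t, whose type is independent of k. *)
Definition class_of t x : {ffun 'I_n -> 'I_t.+1 * 'Z_(p ^ t.+1)} :=
  [ffun i => (inord (capval t (x 0 i)),
              residue (p%:R ^+ (t - capval t (x 0 i)) * x 0 i) t)].

Lemma class_ofP t x y : class_of t y = class_of t x <-> same_class t x y.
Proof.
have scaled c (a b : Zp) : (c <= t)%N ->
    ppow_dvd c.+1 (a - b) <->
    residue (p%:R ^+ (t - c) * a) t = residue (p%:R ^+ (t - c) * b) t.
  move=> ct; rewrite -(ppow_dvd_cancel p_prime (t - c)) addnS subnK // mulrBr.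
  rewrite (ppow_dvdP p_prime) residueB; split=> [/eqP|->]; last by rewrite subrr.
  by rewrite subr_eq0 => /eqP.
split=> [/ffunP xy i|xy].
  have := xy i; rewrite !ffunE => xyi.
  have eq_res : residue (p%:R ^+ (t - capval t (y 0 i)) * y 0 i) t =
      residue (p%:R ^+ (t - capval t (x 0 i)) * x 0 i) t := congr1 snd xyi.
  have eq_cap : inord (capval t (y 0 i)) = inord (capval t (x 0 i)) :> 'I_t.+1
    := congr1 fst xyi.
  move: (congr1 (@nat_of_ord _) eq_cap); rewrite !inordK ?ltnS ?capval_le // => cxy.
  by apply/scaled; rewrite ?capval_le // -cxy eq_res cxy.
apply/ffunP => i; rewrite !ffunE (capval_congr (xy i)); congr pair.
by apply/scaled; rewrite ?capval_le.
Qed.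

End CongruentPoints.

(** * The zeros modulo p^t in one class *)

Section ClassAlternative.
Variables (R : realType) (p n : nat) (p_prime : prime p).
Local Notation Zp := (padic_int p).
Implicit Types (f g : padic_series p n) (x y u v : 'rV[Zp]_n) (k : 'I_n -> nat).

Definition rescale k u : 'rV[Zp]_n := \row_i (p%:R ^+ k i * u 0 i).

(** The substitution x = p^k u multiplies the monomial of exponent w by p to the
weight of w, so p^m factors out of the series when m bounds the weights below. *)
Lemma partial_sum_rescale f k m u D :
  (forall w, f w != 0 -> (m <= weight k w)%N) ->
  partial_sum f (rescale k u) D =
  p%:R ^+ m * partial_sum (fun w => p%:R ^+ (weight k w - m) * f w) u D.
Proof.
move=> mle; rewrite /partial_sum mulr_sumr; apply: eq_bigr => w _.
have -> : \prod_(i < n) rescale k u 0 i ^+ w i =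
    p%:R ^+ weight k w * \prod_(i < n) u 0 i ^+ w i.
  rewrite /weight expr_sum -big_split; apply: eq_bigr => i _ /=.
  by rewrite mxE exprMn exprM.
have [->|fw] := eqVneq (f w) 0; first by rewrite !(mul0r, mulr0).
by rewrite !mulrA -exprD subnKC ?mle // (mulrC (f w)).
Qed.

Lemma tends0_face_part f (tau : set 'rV[R]_n) : coef_tends0 f ->
  coef_tends0 (face_part f tau).
Proof.
move=> f0 t; have [M MP] := f0 t; exists M => w Mw; rewrite /face_part.
by case: ifP => _; [exact: MP|exact: ppow_dvd_zero].
Qed.

Lemma tends0_deriv f i : coef_tends0 f -> coef_tends0 (padic_series_deriv i f).
Proof.
move=> f0 t; have [M MP] := f0 t; exists M => w Mw; apply: ppow_dvdMl.
by apply: MP; rewrite mdegD (leq_trans Mw) // leq_addr.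
Qed.

Lemma eval_eq_on f u v : (forall w, f w != 0 -> forall i, w i != 0 -> u 0 i = v 0 i) ->
  padic_series_eval f u = padic_series_eval f v.
Proof.
move=> fuv; rewrite /padic_series_eval; suff -> : partial_sum f u = partial_sum f v by [].
apply/funext => D; apply: eq_bigr => w _.
have [->|fw] := eqVneq (f w) 0; first by rewrite !mul0r.
congr (_ * _); apply: eq_bigr => i _.
by have [->|wi] := eqVneq (w i) 0%N; [rewrite !expr0|rewrite (fuv w)].
Qed.

Variables (f : padic_series p n) (f_tends0 : coef_tends0 f)
  (f_neq0 : exists w, f w != 0) (f_nondeg : nondegenerated R f) (N : nat).
Hypothesis N_tail : forall w, (N <= mdeg w)%N -> ppow_dvd 1 (f w).

(** Write y = p^k v for y in the class of x.  Then f_D(y) = p^m g_D(v), and modulo p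
both g_D and its derivatives agree with those of the face part phi of f for the
weight k: outside of the face there is an extra factor p, and the terms of degree
at least N are divisible by p.  As v is fixed modulo p, so are these values.
Either p^t divides p^m, or phi does not vanish at v modulo p, or it does and
non-degeneracy provides a coordinate i in which the derivative is a unit; in the
last case, the translations of v_i by multiples of p change g_D(v) / p by unit
multiples.  The choice among the three cases, i and e involves f but not D. *)
Lemma class_alternative t x :
  [\/ forall D y, (N < D)%N -> same_class t x y -> ppow_dvd t (partial_sum f y D),
      forall D y, (N < D)%N -> same_class t x y -> ~ ppow_dvd t (partial_sum f y D) |
      exists i e, forall D y, (N < D)%N -> same_class t x y ->
        exists! j : 'I_(p ^ e), ppow_dvd t (partial_sum f
          (y + (p%:R ^+ (capval t (x 0 i)).+1 *: delta_mx 0 i) *+ j) D)].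
Proof.
pose k i := capval t (x 0 i).
have [m [tau [tau_face [w0 fw0 w0m] mle tauE]]] := face_of_weight R k f_neq0.
pose g : padic_series p n := fun w => p%:R ^+ (weight k w - m) * f w.
have psE u D : partial_sum f (rescale k u) D = p%:R ^+ m * partial_sum g u D.
  exact: partial_sum_rescale.
have [ux uxP] := choice (fun i => ppow_dvd_capval p_prime t (x 0 i) :
  exists z, x 0 i = p%:R ^+ k i * z).
pose u : 'rV[Zp]_n := \row_i ux i.
have classE y : same_class t x y -> exists2 v,
    y = rescale k v & forall i, ppow_dvd 1 (v 0 i - u 0 i).
  move=> yx; have [z zP] := choice yx; exists (\row_i (ux i + p%:R * z i)).
    apply/rowP => i; rewrite !mxE -[LHS](subrK (x 0 i)) zP -/(k i) uxP exprS.
    ring.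
  by move=> i; rewrite !mxE addrC addKr; exists (z i); rewrite expr1.
have [tm|mt] := leqP t m.
  apply: Or31 => D y _ /classE[v -> _]; rewrite psE.
  by apply: ppow_dvdW tm _; exact: ppow_dvd_exp.
pose phi := face_part f tau.
have phi_tends0 : coef_tends0 phi by exact: tends0_face_part.
have g_phi w : ppow_dvd 1 (g w - phi w).
  rewrite /g /phi /face_part; have [->|fw] := eqVneq (f w) 0.
    by rewrite mulr0 if_same subrr; exact: ppow_dvd_zero.
  rewrite tauE //; case: eqVneq => [->|wm].
    by rewrite subnn expr0 mul1r subrr; exact: ppow_dvd_zero.
  rewrite subr0; apply: ppow_dvdMr; apply: (@ppow_dvdW _ 1 (weight k w - m)).
    by rewrite subn_gt0 ltn_neqAle eq_sym wm mle.
  by exists 1; rewrite mulr1.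
have phi_tail w : (N <= mdeg w)%N -> ppow_dvd 1 (phi w).
  by move=> Nw; rewrite -(ppow_dvd_congr (g_phi w)); apply/ppow_dvdMl/N_tail.
(* A coordinate of capped valuation t does not occur on the face, because the
   minimal weight m is smaller than t.  Such a coordinate of u need not be a unit,
   and non-degeneracy is about points with unit coordinates, so it is set to 1. *)
pose uu : 'rV[Zp]_n := \row_i (if k i == t then 1 else ux i).
have phi_vars w i : phi w != 0 -> w i != 0 -> k i != t.
  rewrite /phi /face_part; case: ifP => // [+ fw wi|]; last by rewrite eqxx.
  rewrite tauE // => /eqP wm; apply/eqP => kit.
  move: mt; rewrite -wm ltnNge /weight (bigD1 i) //= kit.
  by rewrite (leq_trans (leq_pmulr _ _) (leq_addr _ _)) // lt0n.
have uu_unit i : uu 0 i \is a GRing.unit.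
  rewrite mxE; case: eqVneq => [_|kit]; first exact: unitr1.
  apply: padic_unit_ndvd => //; apply: (@capval_unit _ p_prime t (x 0 i)) => //.
  by rewrite ltn_neqAle kit capval_le.
have phi_uu : padic_series_eval phi u = padic_series_eval phi uu.
  apply: eval_eq_on => w fw i wi; rewrite !mxE.
  by rewrite (negbTE (phi_vars w i fw wi)).
have dphi_uu i : padic_series_eval (padic_series_deriv i phi) u =
    padic_series_eval (padic_series_deriv i phi) uu.
  apply: eval_eq_on => w fw j wj; rewrite !mxE ifN //.
  apply: (phi_vars (mnm_add w (mnm1 i))).
    by apply: contraNneq fw; rewrite /padic_series_deriv => ->; rewrite mulr0.
  by rewrite mnmDE addn_eq0 negb_and wj.
have psg v D : (N <= D)%N -> (forall i, ppow_dvd 1 (v 0 i - u 0 i)) ->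
    ppow_dvd 1 (partial_sum g v D - padic_series_eval phi uu).
  move=> ND vu; rewrite -phi_uu -(subrKA (partial_sum phi v D)).
  apply: ppow_dvdD; first by apply: partial_sum_congr => w _.
  rewrite -(subrKA (partial_sum phi u D)); apply: ppow_dvdD.
    exact: partial_sum_congr_point.
  rewrite -opprB; apply: ppow_dvdN; exact: eval_congr phi_tail ND.
have psdg i v D : (N <= D)%N -> (forall i, ppow_dvd 1 (v 0 i - u 0 i)) ->
    ppow_dvd 1 (partial_sum (padic_series_deriv i g) v D -
                padic_series_eval (padic_series_deriv i phi) uu).
  move=> ND vu; rewrite -dphi_uu.
  rewrite -(subrKA (partial_sum (padic_series_deriv i phi) v D)).
  apply: ppow_dvdD; first apply: partial_sum_congr => w _.
    by rewrite -mulrBr; exact: ppow_dvdMl.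
  rewrite -(subrKA (partial_sum (padic_series_deriv i phi) u D)); apply: ppow_dvdD.
    exact: partial_sum_congr_point.
  rewrite -opprB; apply: ppow_dvdN; apply: eval_congr ND => //.
    exact: tends0_deriv.
  by move=> w Nw; apply/ppow_dvdMl/phi_tail; rewrite mdegD (leq_trans Nw) // leq_addr.
have [phi0|phiN0] := pselect (ppow_dvd 1 (padic_series_eval phi uu)); last first.
  apply: Or32 => D y ND /classE[v -> vu]; rewrite psE -(subnKC mt) -addn1 -addnA.
  move=> /(ppow_dvd_cancel p_prime); rewrite addnC addn1 => /(ppow_dvdW (ltn0Sn _)).
  by rewrite (ppow_dvd_congr (psg _ _ (ltnW ND) vu)).
have [i dphi] : exists i,
    ~ ppow_dvd 1 (padic_series_eval (padic_series_deriv i phi) uu).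
  apply/existsNP => dphi0; apply: (f_nondeg tau_face).
  exists uu; split; first exact: uu_unit.
    by case: phi0 => z phi_z; exists z; rewrite expr1 in phi_z.
  by move=> i; case: (dphi0 i) => z phi_z; exists z; rewrite expr1 in phi_z.
(* Of the t factors p, m come from the weight and one from the vanishing of phi. *)
apply: Or33; exists i, (t - m).-1 => -[//|D] y; rewrite ltnS => ND /classE[v -> vu].
pose vj (j : nat) := v + (p%:R * j%:R) *: delta_mx 0 i.
have vju j i' : ppow_dvd 1 (vj j 0 i' - u 0 i').
  rewrite mxE [X in _ + X - _]mxE addrAC; apply: ppow_dvdD => //.
  by rewrite -mulrA -[X in X * _]expr1; exact: ppow_dvd_exp.
have transl j : rescale k v + (p%:R ^+ (k i).+1 *: delta_mx 0 i) *+ j =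
    rescale k (vj j).
  apply/rowP => i'; rewrite /vj -scaler_nat !mxE eqxx /=.
  by have [->|_] := eqVneq i' i; rewrite exprS ?mulr0n ?mulr1n; ring.
have h_dvd j : exists z, partial_sum g (vj j) D.+1 = p%:R ^+ 1 * z.
  by apply/(ppow_dvd_congr (psg _ _ (leqW ND) (vju j))); exact: phi0.
have [h hP] := choice h_dvd.
have h_incr j1 j2 : exists c, ~ ppow_dvd 1 c /\ h j1 - h j2 = (j1%:R - j2%:R) * c.
  have [r] := taylor_partial_sum g (vj j2) i (p%:R * (j1%:R - j2%:R)) D.
  have -> : vj j2 + (p%:R * (j1%:R - j2%:R)) *: delta_mx 0 i = vj j1.
    by rewrite /vj -addrA -scalerDl; congr (_ + _ *: _); ring.
  move=> hr; exists (partial_sum (padic_series_deriv i g) (vj j2) D +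
                     p%:R * (j1%:R - j2%:R) * r); split; last first.
    by apply: (@padic_p_cancel _ p_prime 1); rewrite mulrBr -!hP hr expr1 !mulrA.
  rewrite (@ppow_dvd_congr _ _ _ (padic_series_eval (padic_series_deriv i phi) uu)) //.
  rewrite addrAC; apply: ppow_dvdD; first exact: psdg.
  by rewrite -mulrA -[X in X * _]expr1; exact: ppow_dvd_exp.
have eqv j : ppow_dvd t (partial_sum f
    (rescale k v + (p%:R ^+ (k i).+1 *: delta_mx 0 i) *+ j) D.+1) <->
    ppow_dvd (t - m).-1 (h j).
  rewrite transl psE hP mulrA -exprD.
  rewrite -(ppow_dvd_cancel p_prime (m + 1) (t - m).-1 (h j)).
  by rewrite -addnA add1n prednK ?subn_gt0 // subnKC // ltnW.
have [j [hj juniq]] := uniq_zero_mod_ppow p_prime (t - m).-1 h_incr.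
by exists j; split=> [|j']; [exact/eqv|move=> /eqv; exact: juniq].
Qed.

End ClassAlternative.

(** * Translation invariance *)

Section HaarMeasure.
Variables (R : realType) (p n : nat) (p_prime : prime p).
Variables (mu : {measure set (padic_space p n) -> \bar R})
  (mu_haar : normalized_haar mu).
Local Notation Zp := (padic_int p).
Implicit Types (A B C : set (padic_space p n)) (f : padic_series p n).

(** Unions of cosets of (p^t Z_p)^n. *)
Definition stable_mod t (A : set 'rV[Zp]_n) := forall x y : 'rV[Zp]_n, A x ->
  (forall i, ppow_dvd t (y 0 i - x 0 i)) -> A y.

Lemma stable_mod_measurable t A : stable_mod t A -> measurable A.
Proof.
move=> tA; apply: sub_sigma_algebra; rewrite openE => x Ax.
exists (fun i j => [set z | residue z t = residue (x i j) t]).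
  by move=> i j; exists t.
move=> y /= xy; apply: tA Ax _ => i.
apply: (@ppow_dvdW _ t t.+1) => //; apply/(ppow_dvdP p_prime).
by rewrite residueB (xy 0 i) subrr.
Qed.

Lemma stable_modI t A B : stable_mod t A -> stable_mod t B -> stable_mod t (A `&` B).
Proof. by move=> tA tB x y [Ax Bx] xy; split; [exact: tA xy|exact: tB xy]. Qed.

Lemma stable_mod_translate t A v : stable_mod t A -> stable_mod t [set x | A (x + v)].
Proof.
move=> tA x y /= Ax xy; apply: tA Ax _ => i; rewrite !mxE.
by rewrite opprD addrACA subrr addr0.
Qed.

Lemma haar_fin_num A : measurable A -> mu A \is a fin_num.
Proof.
move=> mA; rewrite ge0_fin_numE //; apply: (@le_lt_trans _ _ (mu setT)).
  by apply: le_measure; rewrite ?inE.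
by rewrite (proj1 mu_haar) ltry.
Qed.

(** The translates of the intersection of C and B by -v j, for j < q, partition C,
so B takes up the fraction 1/q of C.  This computes a measure relative to C
without knowing that of C. *)
Lemma measure_transversal C B (v : 'rV[Zp]_n) q t :
  stable_mod t C -> stable_mod t B ->
  (forall x j, C (x + v *+ j) <-> C x) ->
  (forall x, C x -> exists! j : 'I_q, B (x + v *+ j)) ->
  fine (mu C) = fine (mu (C `&` B)) *+ q.
Proof.
move=> tC tB Cv CB.
pose F j : set (padic_space p n) := [set x : 'rV_n | (C `&` B) (x + v *+ j)].
have tF j : stable_mod t (F j) by apply: stable_mod_translate; exact: stable_modI.
have mF j : measurable (F j) by exact: stable_mod_measurable.
have mCB : measurable (C `&` B) by apply: (@stable_mod_measurable t); exact: stable_modI.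
have muF j : mu (F j) = mu (C `&` B).
  rewrite -(proj2 mu_haar (v *+ j) (F j)) //; congr (mu _).
  apply/seteqP; split=> [y [x Fx <-]|y Fy]; first by rewrite addrC.
  by exists (y - v *+ j); [rewrite /F /= subrK|rewrite addrC subrK].
have CE : C = \bigcup_(j in `I_q) F j.
  apply/seteqP; split=> [x Cx|x [j _ [/Cv//]]].
  have [j [Bj _]] := CB x Cx; exists j; first exact: ltn_ord.
  by split=> //; exact/Cv.
have trivF : trivIset `I_q F.
  move=> j1 j2 /= j1q j2q [x [[C1 B1] [_ B2]]].
  have [j [_ juniq]] := CB x (proj1 (Cv _ _) C1).
  have := juniq (Ordinal j1q) B1; rewrite (juniq (Ordinal j2q) B2).
  by move=> /(congr1 val).
have -> : mu C = \sum_(j < q) (fine (mu (C `&` B)))%:E.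
  rewrite [in LHS]CE measure_fin_bigcup; [|exact: finite_II|exact: trivF|by move=> *].
  by rewrite -fsbig_ord; apply: eq_bigr => j _ /=; rewrite muF fineK ?haar_fin_num.
by rewrite sumEFin /= sumr_const card_ord.
Qed.

End HaarMeasure.

(** * The distribution of the absolute value *)

Section TruncationDistribution.
Variables (R : realType) (p n : nat) (p_prime : prime p).
Variables (mu : {measure set (padic_space p n) -> \bar R})
  (mu_haar : normalized_haar mu).
Local Notation Zp := (padic_int p).
Variables (f : padic_series p n) (f_tends0 : coef_tends0 f)
  (f_neq0 : exists w, f w != 0) (f_nondeg : nondegenerated R f) (N : nat).
Hypothesis N_tail : forall w, (N <= mdeg w)%N -> ppow_dvd 1 (f w).

Let zeros_mod t D : set 'rV[Zp]_n := [set y | ppow_dvd t (partial_sum f y D)].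

Let zeros_mod_stable t D : stable_mod t.+1 (zeros_mod t D).
Proof.
move=> x y xD xy; rewrite /zeros_mod /=.
rewrite (@ppow_dvd_congr p t _ (partial_sum f x D)) //.
by apply: partial_sum_congr_point => i; apply: ppow_dvdW (xy i).
Qed.

Let same_class_stable t (x : 'rV[Zp]_n) :
  stable_mod t.+1 [set y : 'rV[Zp]_n | same_class t x y].
Proof.
move=> y z xy yz i; rewrite -(subrKA (y 0 i)); apply: ppow_dvdD => //.
by apply: ppow_dvdW (yz i); rewrite ltnS capval_le.
Qed.

Lemma class_measure_eq t (x : 'rV[Zp]_n) D E : (N < D)%N -> (N < E)%N ->
  mu ([set y : 'rV[Zp]_n | same_class t x y] `&` zeros_mod t D) =
  mu ([set y : 'rV[Zp]_n | same_class t x y] `&` zeros_mod t E).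
Proof.
move=> ND NE; set C := [set y : 'rV[Zp]_n | same_class t x y].
have stC : stable_mod t.+1 C by exact: same_class_stable.
have fin F : mu (C `&` zeros_mod t F) \is a fin_num.
  apply: haar_fin_num => //; apply: (@stable_mod_measurable p n p_prime t.+1).
  by apply: stable_modI => //; exact: zeros_mod_stable.
have [all|none|[i [e trans]]] :=
    class_alternative p_prime f_tends0 f_neq0 f_nondeg N_tail t x.
- have CE F : (N < F)%N -> C `&` zeros_mod t F = C.
    by move=> NF; apply/setIidl => y Cy; exact: all.
  by rewrite !CE.
- have CE F : (N < F)%N -> C `&` zeros_mod t F = set0.
    by move=> NF; apply/seteqP; split=> // y [Cy]; exact: none.
  by rewrite !CE.
pose v : 'rV[Zp]_n := p%:R ^+ (capval t (x 0 i)).+1 *: delta_mx 0 i.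
have Cv y j : C (y + v *+ j) <-> C y.
  have vi i' : ppow_dvd (capval t (x 0 i')).+1
      ((y + v *+ j) 0 i' - x 0 i' - (y 0 i' - x 0 i')).
    rewrite mxE opprB addrA subrK addrC addKr -scaler_nat !mxE eqxx /=.
    apply: ppow_dvdMl; have [->|_] := eqVneq i' i; first exact: ppow_dvd_exp.
    by rewrite mulr0; exact: ppow_dvd_zero.
  by split=> Cy i'; have := Cy i'; rewrite (ppow_dvd_congr (vi i')).
have CE F : (N < F)%N -> fine (mu C) = fine (mu (C `&` zeros_mod t F)) *+ (p ^ e).
  move=> NF; apply: (measure_transversal p_prime mu_haar stC (@zeros_mod_stable t F) Cv).
  by move=> y Cy; exact: trans.
rewrite -[LHS]fineK // -[RHS]fineK //; congr EFin.
apply: (@pmulrnI R (p ^ e)); first by rewrite expn_gt0 prime_gt0.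
by rewrite -!CE.
Qed.

Lemma partial_sum_measure_eq t D E : (N < D)%N -> (N < E)%N ->
  mu (zeros_mod t D) = mu (zeros_mod t E).
Proof.
move=> ND NE; pose C c := [set y : 'rV[Zp]_n | class_of t y = c].
have muE F : mu (zeros_mod t F) = (\sum_(c \in setT) mu (C c `&` zeros_mod t F))%E.
  rewrite -measure_fin_bigcup.
  - congr (mu _); apply/seteqP; split=> [y Fy|y [c _ []//]].
    by exists (class_of t y).
  - exact: finite_finset.
  - by move=> c1 c2 _ _ [y [[<- _] [<- _]]].
  move=> c _; have [[x xc]|noC] := pselect (exists x, class_of t x = c).
    apply: (@stable_mod_measurable p n p_prime t.+1); apply: stable_modI.
      move=> y z <- yz; apply/(class_ofP p_prime) => i.
      by apply: ppow_dvdW (yz i); rewrite ltnS capval_le.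
    exact: zeros_mod_stable.
  rewrite (_ : _ `&` _ = set0) //; apply/seteqP; split=> // y [yc _].
  by apply: noC; exists y.
rewrite !muE; apply: eq_fsbigr => c _.
have [[x <-]|noC] := pselect (exists x, class_of t x = c); last first.
  have C0 : C c = set0 by apply/seteqP; split=> // y yc; apply: noC; exists y.
  by rewrite C0 !set0I.
have -> : C (class_of t x) = [set y : 'rV[Zp]_n | same_class t x y].
  by apply/seteqP; split=> y /(class_ofP p_prime).
exact: class_measure_eq.
Qed.

End TruncationDistribution.

(** * Integrals of functions of the absolute value *)

Section Equidistribution.
Variables (R : realType) (p n : nat) (p_prime : prime p).
Variables (mu : {measure set (padic_space p n) -> \bar R})
  (mu_haar : normalized_haar mu).
Local Notation Zp := (padic_int p).

(** The valuation shifted by one, with the code 0 for the infinite valuation of 0: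
it is equivalent to the absolute value, and takes values in a type all of whose
subsets are measurable. *)
Definition ord_code (z : Zp) : nat :=
  if pselect (exists k, residue z k != 0) is left h then (ex_minn h).+1 else 0%N.

Lemma padic_abs_ord_code (z : Zp) :
  padic_abs R z = if ord_code z is j.+1 then p%:R ^- j else 0.
Proof. by rewrite /padic_abs /ord_code; case: pselect. Qed.

Lemma ord_code0 (z : Zp) : ord_code z = 0%N <-> forall t, ppow_dvd t z.
Proof.
rewrite /ord_code; case: pselect => [h|noz]; split=> //.
  by move=> z0; have [k /eqP[]] := h; apply/(ppow_dvdP p_prime).
move=> _ [|k]; first exact: ppow_dvd0.
by apply/(ppow_dvdP p_prime)/eqP/negPn/negP => zk; apply: noz; exists k.
Qed.

Lemma ord_codeS (z : Zp) j :
  ord_code z = j.+1 <-> ppow_dvd j z /\ ~ ppow_dvd j.+1 z.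
Proof.
rewrite /ord_code; case: pselect => [h|noz]; last first.
  split=> // -[_ zj]; exfalso; apply: zj; apply/(ppow_dvdP p_prime)/eqP/negPn/negP.
  by move=> zj; apply: noz; exists j.
case: ex_minnP => m zm mmin; have zero k : (k < m)%N -> residue z k = 0.
  by move=> km; apply/eqP/negPn/negP => /mmin; rewrite leqNgt km.
have dvdm : ppow_dvd m z.
  case: m {zm mmin} zero => [_|m zero]; first exact: ppow_dvd0.
  exact/(ppow_dvdP p_prime)/zero.
have ndvdm : ~ ppow_dvd m.+1 z by move=> /(ppow_dvdP p_prime)/eqP; apply/negP.
split=> [[<-]//|[zj nzj]]; congr S; apply/eqP; rewrite eqn_leq.
by apply/andP; split; rewrite leqNgt; apply/negP => lt; [apply: nzj|apply: ndvdm];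
  [exact: ppow_dvdW dvdm|exact: ppow_dvdW zj].
Qed.

Definition zero_set (G : padic_space p n -> Zp) t := [set x | ppow_dvd t (G x)].

Lemma ord_code_preimage0 G :
  (ord_code \o G) @^-1` [set 0%N] = \bigcap_t zero_set G t.
Proof.
apply/seteqP; split=> x /=; first by move=> /ord_code0 Gx t _; exact: Gx.
by move=> Gx; apply/ord_code0 => t; exact: Gx.
Qed.

Lemma ord_code_preimageS G j :
  (ord_code \o G) @^-1` [set j.+1] = zero_set G j `\` zero_set G j.+1.
Proof. by apply/seteqP; split=> x /= /ord_codeS. Qed.

Lemma preimage_bigcup1 (T : Type) (phi : T -> nat) Y :
  phi @^-1` Y = \bigcup_(j in Y) (phi @^-1` [set j]).
Proof. by apply/seteqP; split=> [x Yx|x [j Yj /= ->]//]; exists (phi x). Qed.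

Section OneFunction.
Variables (G : padic_space p n -> Zp).
Hypothesis mG : forall t, measurable (zero_set G t).

Lemma measurable_ord_code : measurable_fun [set: padic_space p n] (ord_code \o G).
Proof.
move=> _ Y _; rewrite setTI preimage_bigcup1; apply: bigcup_measurable => -[|j] _.
  by rewrite ord_code_preimage0; exact: bigcap_measurable.
by rewrite ord_code_preimageS; exact: measurableD.
Qed.

Lemma zero_set_nonincreasing : nonincreasing_seq (zero_set G).
Proof. by move=> s t st; apply/subsetPset => x /=; exact: ppow_dvdW. Qed.

End OneFunction.

Variables (G1 G2 : padic_space p n -> Zp).
Hypotheses (mG1 : forall t, measurable (zero_set G1 t))
  (mG2 : forall t, measurable (zero_set G2 t))
  (G12 : forall t, mu (zero_set G1 t) = mu (zero_set G2 t)).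

(** The measure of the zeros is the limit of the measures of the zeros modulo p^t,
and a finite valuation is a difference of two consecutive such sets. *)
Lemma pushforward_ord_code_eq :
  pushforward mu (ord_code \o G1) = pushforward mu (ord_code \o G2) :> (set nat -> _).
Proof.
apply/funext => Y; rewrite /pushforward preimage_bigcup1 [in RHS]preimage_bigcup1.
have mpre G (mG : forall t, measurable (zero_set G t)) j :
    measurable ((ord_code \o G) @^-1` [set j]).
  by rewrite -[X in measurable X]setTI; exact: measurable_ord_code.
have triv (G : padic_space p n -> Zp) :
    trivIset Y (fun j => (ord_code \o G) @^-1` [set j]).
  by move=> i j _ _ [x [/= <- <-]].
rewrite !measure_bigcup //; try by move=> *; exact: mpre.
apply: eq_eseriesr => j _; case: j => [|j].
  rewrite !ord_code_preimage0.
  have cvg G (mG : forall t, measurable (zero_set G t)) :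
      mu \o zero_set G @ \oo --> mu (\bigcap_t zero_set G t).
    apply: nonincreasing_cvg_mu => //; last exact: zero_set_nonincreasing.
      by rewrite ltey_eq (haar_fin_num mu_haar).
    exact: bigcap_measurable.
  have := cvg _ mG1; have -> : mu \o zero_set G1 = mu \o zero_set G2 by apply/funext.
  by move=> /cvg_lim <- //; apply/cvg_lim => //; exact: cvg.
have muD G (mG : forall t, measurable (zero_set G t)) :
    mu (zero_set G j `\` zero_set G j.+1) =
    (mu (zero_set G j) - mu (zero_set G j.+1))%E.
  rewrite measureD ?(@setIidr _ (zero_set G j)) //.
    by move=> x; exact: ppow_dvdW.
  by rewrite ltey_eq (haar_fin_num mu_haar).
by rewrite !ord_code_preimageS !muD // !G12.
Qed.

Lemma Rintegral_padic_abs_eq (h : R -> R) :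
  \int[mu]_x h (padic_abs R (G1 x)) = \int[mu]_x h (padic_abs R (G2 x)).
Proof.
pose H (j : nat) : \bar R := (h (if j is j'.+1 then p%:R ^- j' else 0))%:E.
suff intE G (mG : forall t, measurable (zero_set G t)) :
    (\int[mu]_x (h (padic_abs R (G x)))%:E =
     \int[pushforward mu (ord_code \o G)]_j H^\+ j -
     \int[pushforward mu (ord_code \o G)]_j H^\- j)%E.
  by rewrite /Rintegral !intE // pushforward_ord_code_eq.
have mphi := measurable_ord_code mG.
have push (K : nat -> \bar R) : (forall j, (0 <= K j)%E) ->
    (\int[pushforward mu (ord_code \o G)]_j K j =
     \int[mu]_x K (ord_code (G x)))%E.
  by move=> K0; rewrite (@ge0_integral_pushforward _ _ _ _ _ _ mphi mu setT K) //.
rewrite !push; [|by move=> j; exact: funeneg_ge0|by move=> j; exact: funepos_ge0].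
have -> : (fun x => (h (padic_abs R (G x)))%:E) = H \o (ord_code \o G).
  by apply/funext => x; rewrite /H /= padic_abs_ord_code.
by rewrite integralE funepos_comp funeneg_comp.
Qed.

End Equidistribution.

Theorem proposition4p5 (R : realType) (p n : nat) (p_prime : prime p)
    (n_ge1 : (1 <= n)%N)
    (mu : {measure set (padic_space p n) -> \bar R})
    (mu_haar : normalized_haar mu)
    (f : padic_series p n) (f_restricted : restricted R f)
    (f_neq0 : exists w, f w != 0) (f0 : padic_series_eval f 0 = 0)
    (f_nondeg : nondegenerated R f) :
  exists N : nat, forall D : nat, (N <= D)%N ->
    forall s : R[i], 0 < complex.Re s ->
      igusa_zeta mu (truncation D f) s = igusa_zeta mu f s.
Proof.
have f_tends0 := restricted_tends0 p_prime f_restricted.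
have [N N_tail] := f_tends0 1%N; exists N.+1 => D ND s _.
have zeros_f t : exists2 E, (N < E)%N &
    zero_set (padic_series_eval f) t = [set y | ppow_dvd t (partial_sum f y E)].
  have [M M_tail] := f_tends0 t; exists (maxn N.+1 M); first exact: leq_maxl.
  have fE y := eval_congr p_prime y f_tends0 M_tail (leq_maxr N.+1 M).
  by apply/seteqP; split=> y; rewrite /zero_set /= (ppow_dvd_congr (fE y)).
have zeros_D t : zero_set (padic_series_eval (truncation D f)) t =
    [set y | ppow_dvd t (partial_sum f y D)].
  by apply/seteqP; split=> y; rewrite /zero_set /= eval_truncation.
have mzeros t E : measurable
    ([set y | ppow_dvd t (partial_sum f y E)] : set (padic_space p n)).
  apply: (@stable_mod_measurable p n p_prime t) => x y xE xy /=.
  rewrite (@ppow_dvd_congr p t _ (partial_sum f x E)) //.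
  exact: partial_sum_congr_point.
have m_f t : measurable (zero_set (padic_series_eval f : padic_space p n -> _) t).
  by have [E _ ->] := zeros_f t.
have m_D t : measurable
    (zero_set (padic_series_eval (truncation D f) : padic_space p n -> _) t).
  by rewrite zeros_D.
have eq_mu t : mu (zero_set (padic_series_eval (truncation D f)) t) =
    mu (zero_set (padic_series_eval f) t).
  have [E NE ->] := zeros_f t; rewrite zeros_D.
  exact: (partial_sum_measure_eq p_prime mu_haar f_tends0 f_neq0 f_nondeg N_tail).
have eq_int := Rintegral_padic_abs_eq p_prime mu_haar m_D m_f eq_mu.
have eq_re := eq_int (fun a => complex.Re (cpow a s)).
have eq_im := eq_int (fun a => complex.Im (cpow a s)).
rewrite /igusa_zeta.
rewrite eq_re eq_im; reflexivity.
Qed.
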